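(* Let $K\subset\mathbb{R}^d$ be a bounded measurable set with non-empty interior, let $\rho\colon K\to[0,\infty)$ be Lebesgue-integrable with $\int_K\rho(x)\,\mathrm{d}x>0$, and let $\pi$ be the probability measure on $K$ given by $\pi(A)=\int_A\rho(x)\,\mathrm{d}x\big/\int_K\rho(x)\,\mathrm{d}x$. Let $U_0$ be the uniform distribution on $K$ and let $B$ be a Markov kernel on $K$ (the proposal kernel) that is reversible with respect to $U_0$ and whose Markov operator is positive on $L_2(U_0)$. Then the Markov operator $M$ of the Metropolis algorithm with proposal $B$, defined for $f\in L_2(\pi)$ by $$Mf(x)=\int_K f(y)\,\alpha(x,y)\,B(x,\mathrm{d}y)+\left(1-\int_K\alpha(x,y)\,B(x,\mathrm{d}y)\right)f(x),\qquad \alpha(x,y)=\min\left\{1,\frac{\rho(y)}{\rho(x)}\right\},$$ is a positive operator on $L_2(\pi)$.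
   Context: For a probability measure $\nu$, $L_2(\nu)$ is the real Hilbert space of ($\nu$-a.e. equivalence classes of) $\nu$-square-integrable real functions with inner product $\langle f,g\rangle_\nu=\int f g\,\mathrm{d}\nu$. A Markov kernel $Q$ is identified with its Markov operator $Qf(x)=\int f(y)\,Q(x,\mathrm{d}y)$. The kernel $Q$ is reversible with respect to $\nu$ if $\int_A Q(x,A')\,\nu(\mathrm{d}x)=\int_{A'}Q(x,A)\,\nu(\mathrm{d}x)$ for all measurable $A,A'$; then its Markov operator is self-adjoint on $L_2(\nu)$. A self-adjoint operator $P$ on $L_2(\nu)$ is called positive if $\langle Pf,f\rangle_\nu\ge0$ for all $f\in L_2(\nu)$. The uniform distribution on $K$ is $U_0(A)=\mathrm{vol}_d(A\cap K)/\mathrm{vol}_d(K)$, where $\mathrm{vol}_d$ is $d$-dimensional Lebesgue measure. $Mf$ is understood as defined $\pi$-almost everywhere (in particular only points $x$ with $\rho(x)>0$ matter). *)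

(* Defs.v *)
From HB Require Import structures.
From mathcomp Require Import all_boot all_order all_algebra.
From mathcomp Require Import all_classical all_reals all_analysis.

Set Implicit Arguments.
Unset Strict Implicit.
Unset Printing Implicit Defensive.
Import Order.TTheory GRing.Theory Num.Theory numFieldNormedType.Exports.

Local Open Scope classical_set_scope.
Local Open Scope ring_scope.

(* The sigma-algebra on R^n is generated by the coordinate maps; since R is
   second countable this is the Borel sigma-algebra of the product topology. *)
Definition rV_display : measure_display. Proof. exact. Qed.

Section measurable_rV.
Context {R : realType}.
Variable n : nat.

Definition rV_measurable : set (set 'rV[R]_n) :=
  g_sigma_preimage (fun (i : 'I_n) (x : 'rV[R]_n) => x ord0 i).

Let rV_set0 : rV_measurable set0.
Proof. exact: sigma_algebra0. Qed.

Let rV_setC A : rV_measurable A -> rV_measurable (~` A).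
Proof. exact: sigma_algebraC. Qed.

Let rV_bigcup (F : _^nat) : (forall i, rV_measurable (F i)) ->
  rV_measurable (\bigcup_i (F i)).
Proof. exact: sigma_algebra_bigcup. Qed.

HB.instance Definition _ := @isMeasurable.Build rV_display
  'rV[R]_n rV_measurable rV_set0 rV_setC rV_bigcup.

End measurable_rV.

Lemma measurable_coord (R : realType) n (i : 'I_n) :
  measurable_fun [set: 'rV[R]_n] (fun x : 'rV[R]_n => x ord0 i).
Proof.
move=> _ Y mY; rewrite setTI; apply: sub_sigma_algebra => /=.
rewrite -bigcup_seq/=; exists i => /=; first by rewrite mem_index_enum.
by exists Y => //; rewrite setTI.
Qed.

Lemma measurable_fun_rV d (T : measurableType d) (R : realType) n
    (f : T -> 'rV[R]_n) :
  (forall i, measurable_fun [set: T] (fun t => f t ord0 i)) ->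
  measurable_fun [set: T] f.
Proof.
move=> mf; apply: (@measurability _ _ _ _ setT f
  (\big[setU/set0]_(i < n) preimage_set_system setT
     (fun x : 'rV[R]_n => x ord0 i) measurable)) => //.
move=> _ [B + <-]; rewrite -bigcup_seq => -[i _ [C mC <-]].
by rewrite !setTI; have := mf i measurableT C mC; rewrite setTI.
Qed.

(* Identifies R^n * R with R^(n+1); the real becomes the first coordinate. *)
Definition cons_rV (R : realType) n (p : 'rV[R]_n * R) : 'rV[R]_n.+1 :=
  row_mx (const_mx p.2 : 'rV[R]_1) p.1.

Lemma measurable_cons_rV (R : realType) n :
  measurable_fun [set: 'rV[R]_n * measurableTypeR R] (@cons_rV R n).
Proof.
apply: measurable_fun_rV => i; rewrite /cons_rV.
case: (splitP (i : 'I_(1 + n))) => j ij.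
- rewrite (_ : (fun _ => _) = snd); first exact: measurable_snd.
  apply/funext => t; rewrite (_ : i = lshift n j); last exact: val_inj.
  exact: etrans (row_mxEl _ _ _ _) (mxE _ _ _ _).
- rewrite (_ : (fun _ => _) = (fun x : 'rV[R]_n => x ord0 j) \o fst).
    by apply: measurableT_comp; [exact: measurable_coord|exact: measurable_fst].
  apply/funext => t; rewrite (_ : i = rshift 1 j); last exact: val_inj.
  exact: row_mxEr.
Qed.

Section lebesgue_rV_step.
Local Open Scope ereal_scope.
Context {R : realType}.
Variables (n : nat) (mu : {measure set 'rV[R]_n -> \bar R}).

Definition lebesgue_rV_step : set 'rV[R]_n.+1 -> \bar R :=
  pushforward (mu \x @lebesgue_measure R) (@cons_rV R n).

Let step0 : lebesgue_rV_step set0 = 0.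
Proof. by rewrite /lebesgue_rV_step /pushforward preimage_set0 measure0. Qed.

Let step_ge0 A : 0 <= lebesgue_rV_step A.
Proof. by rewrite /lebesgue_rV_step /pushforward. Qed.

Let step_sigma_additive : semi_sigma_additive lebesgue_rV_step.
Proof.
move=> F mF tF mUF; rewrite /lebesgue_rV_step /pushforward preimage_bigcup.
have mpre A : measurable A -> measurable (@cons_rV R n @^-1` A).
  move=> mA; rewrite -[X in measurable X]setTI.
  exact: (measurable_cons_rV measurableT mA).
apply: measure_semi_sigma_additive.
- by move=> i; exact: mpre.
- apply/trivIsetP => /= i j _ _ ij; rewrite -preimage_setI.
  by move/trivIsetP : tF => /(_ _ _ _ _ ij) ->//; rewrite preimage_set0.
- by rewrite -preimage_bigcup; exact: mpre.
Qed.

HB.instance Definition _ := isMeasure.Build _ _ _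
  lebesgue_rV_step step0 step_ge0 step_sigma_additive.

End lebesgue_rV_step.

(* n-dimensional Lebesgue measure, as an iterated product; R^0 is a point of
   mass 1. *)
Fixpoint lebesgue_rV (R : realType) n : {measure set 'rV[R]_n -> \bar R} :=
  match n with
  | 0 => dirac (0 : 'rV[R]_0)
  | n'.+1 => lebesgue_rV_step (lebesgue_rV R n')
  end.

Lemma lebesgue_rV_box (R : realType) n (a b : 'I_n -> R) :
  (forall i, a i <= b i) ->
  lebesgue_rV R n [set x | forall i, x ord0 i \in `[a i, b i]] =
  (\prod_(i < n) (b i - a i))%:E.
Proof.
elim: n a b => [|n IHn] a b ab.
  by rewrite big_ord0 /= diracE mem_set// => -[].
pose l := fun i : 'I_n => lift ord0 i.
pose box : set 'rV[R]_n := [set x | forall i, x ord0 i \in `[a (l i), b (l i)]].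
have c0 p : @cons_rV R n p ord0 ord0 = p.2.
  rewrite /cons_rV (_ : ord0 = lshift n (ord0 : 'I_1)); last exact: val_inj.
  exact: etrans (row_mxEl _ _ _ _) (mxE _ _ _ _).
have cl p i : @cons_rV R n p ord0 (l i) = p.1 ord0 i.
  rewrite /cons_rV (_ : l i = rshift 1 i); last exact: val_inj.
  exact: row_mxEr.
have boxE : @cons_rV R n @^-1` [set x | forall i, x ord0 i \in `[a i, b i]] =
    box `*` `[a ord0, b ord0]%classic.
  apply/seteqP; split => p /=.
    move=> h; split => [i|]; first by rewrite -cl; exact: h.
    by have := h ord0; rewrite c0.
  move=> [h1 h2] i; have [j ->|->] := unliftP ord0 i; last by rewrite c0.
  by rewrite cl; exact: h1.
have mbox : measurable box.
  rewrite (_ : box = \bigcap_(i in [set: 'I_n])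
      ((fun x : 'rV[R]_n => x ord0 i) @^-1` `[a (l i), b (l i)]%classic)).
    apply: fin_bigcap_measurable => // i _.
    rewrite -[X in measurable X]setTI.
    by apply: (@measurable_coord R n i) => //; exact: measurable_itv.
  by apply/seteqP; split => x /= h i; [move=> _; exact: h|exact: h i I].
transitivity ((lebesgue_rV R n \x @lebesgue_measure R)
    (box `*` `[a ord0, b ord0]%classic))%E; first by rewrite -boxE.
rewrite product_measure1E//.
rewrite IHn; last by move=> i; exact: ab.
have := @lebesgue_measure_itv R `[a ord0, b ord0] => /= ->.
rewrite lte_fin big_ord_recl/= [RHS]EFinM muleC.
by case: ltgtP (ab ord0) => // -> _; rewrite subrr.
Qed.

Lemma nonempty_interior (T : topologicalType) (K : set T) :
  K° !=set0 -> K !=set0.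
Proof. by move=> [x Kx]; exists x; exact: interior_subset Kx. Qed.

Definition trace_display : measure_display -> measure_display.
Proof. exact. Qed.

(* A nonempty subset K as a measurable space in its own right, with the trace
   sigma-algebra; nonemptiness is needed because measurable types are pointed. *)
Definition trace_type d (T : measurableType d) (K : set T)
  (K0 : K !=set0) : Type := set_type K.

Section trace_type.
Context d (T : measurableType d) (K : set T) (K0 : K !=set0).
Local Notation S := (trace_type K0).

HB.instance Definition _ := gen_eqMixin S.
HB.instance Definition _ := gen_choiceMixin S.
HB.instance Definition _ := isPointed.Build S
  (SigSub (mem_set (projT2 (cid K0)))).

Definition trace_val (x : S) : T := set_val x.

Definition trace_measurable : set (set S) :=
  preimage_set_system setT trace_val measurable.

Let sigma_algebra_trace : sigma_algebra setT trace_measurable.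
Proof. exact/sigma_algebra_preimage/sigma_algebra_measurable. Qed.

Let trace_set0 : trace_measurable set0.
Proof. by have [] := sigma_algebra_trace. Qed.

Let trace_setC A : trace_measurable A -> trace_measurable (~` A).
Proof. by have [_ + _] := sigma_algebra_trace; rewrite -setTD; apply. Qed.

Let trace_bigcup (F : (set S)^nat) : (forall i, trace_measurable (F i)) ->
  trace_measurable (\bigcup_i (F i)).
Proof. by have [_ _] := sigma_algebra_trace; apply. Qed.

HB.instance Definition _ := @isMeasurable.Build (trace_display d)
  S trace_measurable trace_set0 trace_setC trace_bigcup.

End trace_type.
Arguments trace_val {d T K K0}.

Section trace_measure.
Local Open Scope ereal_scope.
Context d (T : measurableType d) (R : realType).
Variables (mu : {measure set T -> \bar R}) (K : set T).
Variables (mK : measurable K) (K0 : K !=set0).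

(* [mK] is an argument because it is what makes this a measure. *)
Definition trace_measure of measurable K : set (trace_type K0) -> \bar R :=
  fun A => mu (trace_val @` A).

Let inj_trace_val : injective (@trace_val _ T K K0).
Proof. exact: val_inj. Qed.

Let image_measurable (A : set (trace_type K0)) :
  measurable A -> measurable (trace_val @` A).
Proof.
move=> [B mB <-]; rewrite setTI (_ : _ @` _ = K `&` B).
  exact: measurableI.
apply/seteqP; split => [_ [x Bx <-]|x [Kx Bx]].
  by split => //; exact: set_mem (valP x).
by exists (SigSub (mem_set Kx) : trace_type K0).
Qed.

Let trace0 : trace_measure mK set0 = 0.
Proof. by rewrite /trace_measure image_set0 measure0. Qed.

Let trace_ge0 A : 0 <= trace_measure mK A.
Proof. exact: measure_ge0. Qed.

Let trace_sigma_additive : semi_sigma_additive (trace_measure mK).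
Proof.
move=> F mF tF mUF; rewrite /trace_measure image_bigcup.
apply: measure_semi_sigma_additive.
- by move=> i; exact: image_measurable.
- apply/trivIsetP => i j _ _ ij; apply/seteqP; split => // x /=.
  move=> [[y Fy <-] [z Fz /inj_trace_val zy]].
  move/trivIsetP : tF => /(_ _ _ I I ij); rewrite -subset0 => /(_ y); apply.
  by split => //; rewrite -zy.
- by rewrite -image_bigcup; exact: image_measurable.
Qed.

HB.instance Definition _ := isMeasure.Build _ _ _
  (trace_measure mK) trace0 trace_ge0 trace_sigma_additive.

End trace_measure.

Section operators.
Context d (T : measurableType d) (R : realType).

(* Elements of L_2(nu) are represented by functions in [Lfun nu 2], equal
   elements being those that agree nu-almost everywhere. *)
Definition L2_inner (nu : {measure set T -> \bar R}) (f g : T -> R) : R :=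
  \int[nu]_x (f x * g x).

(* P induces a linear map from L_2(nu) to itself. *)
Definition L2_operator (nu : {measure set T -> \bar R})
    (P : (T -> R) -> (T -> R)) : Prop :=
  [/\ forall f, f \in Lfun nu 2%:E -> P f \in Lfun nu 2%:E,
      forall f g, f \in Lfun nu 2%:E -> g \in Lfun nu 2%:E ->
        {ae nu, forall x, f x = g x} -> {ae nu, forall x, P f x = P g x} &
      forall (a : R) f g, f \in Lfun nu 2%:E -> g \in Lfun nu 2%:E ->
        {ae nu, forall x,
          P (fun y => a * f y + g y) x = a * P f x + P g x}].

Definition L2_self_adjoint (nu : {measure set T -> \bar R})
    (P : (T -> R) -> (T -> R)) : Prop :=
  forall f g, f \in Lfun nu 2%:E -> g \in Lfun nu 2%:E ->
    L2_inner nu (P f) g = L2_inner nu f (P g).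

Definition L2_positive (nu : {measure set T -> \bar R})
    (P : (T -> R) -> (T -> R)) : Prop :=
  forall f, f \in Lfun nu 2%:E -> 0 <= L2_inner nu (P f) f.

Definition reversible (Q : R.-pker T ~> T)
    (nu : {measure set T -> \bar R}) : Prop :=
  forall A A' : set T, measurable A -> measurable A' ->
    (\int[nu]_(x in A) Q x A' = \int[nu]_(x in A') Q x A)%E.

Definition markov_op (Q : R.-pker T ~> T) (f : T -> R) : T -> R :=
  fun x => \int[Q x]_y f y.

(* Where rho x = 0 the quotient is 0 by convention; such x form a null set for
   the distribution with density rho. *)
Definition acceptance (rho : T -> R) (x y : T) : R :=
  Num.min 1 (rho y / rho x).

Definition metropolis_op (rho : T -> R) (B : R.-pker T ~> T)
    (f : T -> R) : T -> R :=
  fun x => \int[B x]_y (f y * acceptance rho x y)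
    + (1 - \int[B x]_y acceptance rho x y) * f x.

End operators.

(* Main.v *)
(* Let [r] be the density of [pi] with respect to [U0] and [m] the law
   U0(dx) B(x,dy) on pairs, which is invariant under exchanging x and y by
   reversibility. Since alpha(x,y) r(x) = min(r(x), r(y)),
     <M f, g>_pi = int f(y) g(x) min(r(x), r(y)) dm(x,y)
                   + int (1 - a(x)) f(x) g(x) dpi(x),
   where a(x) is the acceptance probability at x. Both terms are symmetric, and
   the second is nonnegative for f = g. For the first one, write
   min(r(x), r(y)) as the integral over t > 0 of 1[t < r(x)] 1[t < r(y)]: it
   becomes the integral over t > 0 of <B f_t, f_t>_U0 >= 0, where
   f_t = f 1[t < r] belongs to L_2(U0) even if f does not. Boundedness on L_2(pi)
   follows from (int f alpha dB)^2 <= int f^2 alpha dB and the symmetry of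
   m. *)
From HB Require Import structures.
Require Import Defs.
From mathcomp Require Import all_boot all_order all_algebra.
From mathcomp Require Import all_classical all_reals all_analysis.
From mathcomp Require Import measurable_realfun ring lra.

Set Implicit Arguments.
Unset Strict Implicit.
Unset Printing Implicit Defensive.
Import Order.TTheory GRing.Theory Num.Theory numFieldNormedType.Exports.

Local Open Scope classical_set_scope.
Local Open Scope ring_scope.

(** * The joint law [U(dx) B(x,dy)] of a starting point and one step of the kernel *)

Section joint_law.
Context d d' (X : measurableType d) (Y : measurableType d') (R : realType).
Variables (U : probability X R) (B : R.-pker X ~> Y).
Local Open Scope ereal_scope.

(* [kcomp] composes parameterized kernels, hence the dummy parameter here, as
   well as the first component in [graph_kernel]. *)
Definition start_kernel : X -> {measure set X -> \bar R} := fun=> U.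

Let measurable_start_kernel A : measurable A ->
  measurable_fun [set: X] (start_kernel ^~ A).
Proof. by move=> mA; exact: measurable_cst. Qed.

HB.instance Definition _ := isKernel.Build _ _ _ _ _
  start_kernel measurable_start_kernel.

Let start_kernel_setT x : start_kernel x [set: X] = 1.
Proof. exact: probability_setT. Qed.

HB.instance Definition _ := Kernel_isProbability.Build _ _ _ _ _
  start_kernel start_kernel_setT.

(** Law of [(x, y)] with [y] drawn from [B x]. Pushing [B x] forward along the section map keeps the
    starting point, which composing with [B] itself would integrate out. *)
Definition graph_kernel (p : X * X) : {measure set (X * Y) -> \bar R} :=
  measure_function_pushforward__canonical__measure_function_Measure
    (B p.2) (pair1_measurable p.2).

Let measurable_graph_kernel (A : set (X * Y)) : measurable A ->
  measurable_fun [set: X * X] (graph_kernel ^~ A).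
Proof.
move=> mA; rewrite (_ : graph_kernel ^~ A =
    (fun x => B x (xsection A x)) \o snd).
  apply: measurableT_comp; last exact: measurable_snd.
  by apply: measurable_fun_xsection_finite_kernel; rewrite inE.
by apply/funext => p; rewrite /= /graph_kernel /pushforward -xsectionE.
Qed.

HB.instance Definition _ := isKernel.Build _ _ _ _ _
  graph_kernel measurable_graph_kernel.

Let graph_kernel_setT p : graph_kernel p [set: X * Y] = 1.
Proof. exact: prob_kernel. Qed.

HB.instance Definition _ := Kernel_isProbability.Build _ _ _ _ _
  graph_kernel graph_kernel_setT.

Definition joint_law : set (X * Y) -> \bar R :=
  kcomp start_kernel graph_kernel point.

HB.instance Definition _ :=
  Measure.copy joint_law (kcomp start_kernel graph_kernel point).

Lemma joint_lawE A : joint_law A = \int[U]_x B x (xsection A x).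
Proof. by apply: eq_integral => x _; rewrite xsectionE. Qed.

Let joint_law_setT : joint_law setT = 1.
Proof.
rewrite joint_lawE; under eq_integral do
  rewrite xsectionE preimage_setT prob_kernel.
by rewrite integral_cst// mul1e; exact: probability_setT.
Qed.

HB.instance Definition _ := Measure_isProbability.Build _ _ _
  joint_law joint_law_setT.

Lemma ge0_integral_joint_law (h : X * Y -> \bar R) :
  measurable_fun setT h -> (forall z, 0 <= h z) ->
  \int[joint_law]_z h z = \int[U]_x \int[B x]_y h (x, y).
Proof.
move=> mh h0; rewrite integral_kcomp//; apply: eq_integral => x _.
by rewrite ge0_integral_pushforward.
Qed.

Lemma measurable_kernel_integral (h : X * Y -> \bar R) :
  measurable_fun setT h -> (forall z, 0 <= h z) ->
  measurable_fun setT (fun x => \int[B x]_y h (x, y)).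
Proof. by move=> mh h0; exact: measurable_fun_integral_finite_kernel. Qed.

End joint_law.

(** * Fubini's theorem for signed integrands against the joint law *)

Section joint_law_integral.
Context d d' (X : measurableType d) (Y : measurableType d') (R : realType).
Variables (U : probability X R) (B : R.-pker X ~> Y).
Local Open Scope ereal_scope.
Local Notation m := (joint_law U B).

Lemma measurable_kernel_integral_signed (h : X * Y -> \bar R) :
  measurable_fun setT h ->
  measurable_fun setT (fun x => \int[B x]_y h (x, y)).
Proof.
move=> mh; rewrite (_ : (fun x => _) = (fun x => \int[B x]_y h^\+ (x, y)) \-
    (fun x => \int[B x]_y h^\- (x, y))); last first.
  apply/funext => x; rewrite [LHS]integralE.
  under eq_integral do rewrite funepos_comp/=.
  by under [X in _ - X = _]eq_integral do rewrite funeneg_comp/=.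
apply: emeasurable_funB; apply: measurable_kernel_integral => //.
  exact: measurable_funepos.
exact: measurable_funeneg.
Qed.

Lemma measurable_kernel_Rintegral (h : X * Y -> R) :
  measurable_fun setT h ->
  measurable_fun setT (fun x => \int[B x]_y h (x, y))%R.
Proof.
move=> mh; apply: measurableT_comp; first exact: fine_measurable.
apply: (@measurable_kernel_integral_signed (EFin \o h)).
exact/measurable_EFinP.
Qed.

Lemma integrable_joint_lawP (h : X * Y -> \bar R) : measurable_fun setT h ->
  m.-integrable setT h <-> \int[U]_x \int[B x]_y `|h (x, y)| < +oo.
Proof.
move=> mh; rewrite -(ge0_integral_joint_law U B (h := abse \o h)); last 2 first.
- exact: measurableT_comp.
- by move=> z; exact: abse_ge0.
by split=> [/integrableP[]|?] //; apply/integrableP.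
Qed.

(** By Tonelli the integrals of [|h|] over the sections form a [U]-integrable function, which is
    therefore finite almost everywhere. *)
Lemma ae_integrable_joint_law (h : X * Y -> \bar R) : m.-integrable setT h ->
  {ae U, forall x, (B x).-integrable setT (fun y => h (x, y))}.
Proof.
move=> ih; have mh := measurable_int _ ih.
have mF : measurable_fun setT (fun x => \int[B x]_y `|h (x, y)|).
  apply: (@measurable_kernel_integral _ _ _ _ _ B (abse \o h)).
    exact: measurableT_comp.
  by move=> z; exact: abse_ge0.
have : U.-integrable setT (fun x => \int[B x]_y `|h (x, y)|).
  apply/integrableP; split => //.
  under eq_integral do rewrite gee0_abs ?integral_ge0//.
  exact/(integrable_joint_lawP mh).1.
move/integrable_ae => /(_ measurableT); apply: filterS => x /= /(_ I) fx.
apply/integrableP; split; first exact: measurableT_comp.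
by move/fin_numPlt : fx => /andP[].
Qed.

Lemma integral_joint_law (h : X * Y -> \bar R) : m.-integrable setT h ->
  \int[m]_z h z = \int[U]_x \int[B x]_y h (x, y).
Proof.
move=> ih; have mh := measurable_int _ ih.
have iF (g : X * Y -> \bar R) : measurable_fun setT g -> (forall z, 0 <= g z) ->
    m.-integrable setT g -> U.-integrable setT (fun x => \int[B x]_y g (x, y)).
  move=> mg g0 ig; apply/integrableP; split.
    exact: measurable_kernel_integral.
  under eq_integral do rewrite gee0_abs ?integral_ge0//.
  by rewrite -ge0_integral_joint_law//; exact: integrable_lty.
have mhp := measurable_funepos mh; have mhn := measurable_funeneg mh.
rewrite integralE !ge0_integral_joint_law// -integralB//.
- apply: eq_integral => x _; rewrite [RHS]integralE.
  under [in RHS]eq_integral do rewrite funepos_comp/=.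
  by under [X in _ = _ - X]eq_integral do rewrite funeneg_comp/=.
- by apply: iF => //; exact: integrable_funepos.
- by apply: iF => //; exact: integrable_funeneg.
Qed.

Lemma Rintegral_joint_law (h : X * Y -> R) : m.-integrable setT (EFin \o h) ->
  (\int[m]_z h z = \int[U]_x \int[B x]_y h (x, y))%R.
Proof.
move=> ih; have mh : measurable_fun setT h.
  by apply/measurable_EFinP; exact: measurable_int ih.
rewrite {1}/Rintegral integral_joint_law//; congr fine.
(* The real inner integral is [fine] of the extended one. Wrapping it back with [EFin] is harmless
   where the section is integrable, hence almost everywhere. *)
apply: ae_eq_integral => //.
- exact: (measurable_kernel_integral_signed (measurable_int _ ih)).
- by apply/measurable_EFinP; exact: measurable_kernel_Rintegral.
- have := ae_integrable_joint_law ih; apply: filterS => x /= hx _.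
  by rewrite /Rintegral fineK//; exact: integrable_fin_num.
Qed.

Lemma joint_law_setX A A' : measurable A -> measurable A' ->
  m (A `*` A') = \int[U]_(x in A) B x A'.
Proof.
move=> mA mA'; rewrite joint_lawE [RHS]integral_mkcond; apply: eq_integral => x _.
rewrite patchE; case: ifPn => xA; first by rewrite in_xsectionX.
by rewrite notin_xsectionX// measure0.
Qed.

End joint_law_integral.

(** * Exchange symmetry of the joint law of a reversible kernel *)

Section reversible_joint_law.
Context d (T : measurableType d) (R : realType).
Variables (U : probability T R) (B : R.-pker T ~> T).
Hypothesis rev : reversible B U.
Local Open Scope ereal_scope.
Local Notation m := (joint_law U B).

Let swapped :=
  measure_function_pushforward__canonical__measure_function_Measure m
    (@measurable_swap _ _ T T).

(** Reversibility is this symmetry tested on rectangles. These are stable under intersection and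
    generate the product sigma-algebra, so they determine a finite measure. *)
Lemma pushforward_swap_joint_law A : measurable A ->
  pushforward m (fun z => (z.2, z.1)) A = m A.
Proof.
pose C : set (set (T * T)) :=
  [set A `*` B | A in measurable & B in measurable].
apply: (@measure_unique _ _ _ C (fun=> setT) _ _ _ _
  swapped m).
- exact: measurable_prod_measurableType.
- move=> _ _ [A1 mA1 [B1 mB1 <-]] [A2 mA2 [B2 mB2 <-]].
  exists (A1 `&` A2); first exact: measurableI.
  by exists (B1 `&` B2); [exact: measurableI|rewrite setXI].
- by move=> _; exists setT => //; exists setT => //; rewrite setXTT.
- by rewrite bigcup_const//; exists 0%N.
- move=> _ [A1 mA1 [A2 mA2 <-]]; rewrite /= /pushforward.
  rewrite (_ : (fun z => (z.2, z.1)) @^-1` (A1 `*` A2) = A2 `*` A1).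
    by rewrite !joint_law_setX// rev.
  by apply/seteqP; split => -[x y] [].
- by move=> _; rewrite /= /pushforward preimage_setT probability_setT ltry.
Qed.

Lemma ge0_integral_joint_law_swap (h : T * T -> \bar R) :
  measurable_fun setT h -> (forall z, 0 <= h z) ->
  \int[m]_z h (z.2, z.1) = \int[m]_z h z.
Proof.
move=> mh h0; transitivity (\int[swapped]_z h z).
  by rewrite ge0_integral_pushforward//; exact: measurable_swap.
by apply: eq_measure_integral => A mA _; exact: pushforward_swap_joint_law.
Qed.

Lemma integrable_joint_law_swap (h : T * T -> \bar R) :
  m.-integrable setT h -> m.-integrable setT (fun z => h (z.2, z.1)).
Proof.
move=> /integrableP[mh ih]; apply/integrableP; split.
  exact: (measurableT_comp mh (@measurable_swap _ _ T T)).
rewrite (ge0_integral_joint_law_swap (h := abse \o h)) => //.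
  exact: measurableT_comp.
by move=> z; exact: abse_ge0.
Qed.

Lemma Rintegral_joint_law_swap (h : T * T -> R) :
  m.-integrable setT (EFin \o h) ->
  (\int[m]_z h (z.2, z.1) = \int[m]_z h z)%R.
Proof.
move=> ih; have mh := measurable_int _ ih.
congr fine; transitivity (\int[swapped]_z (h z)%:E).
  rewrite integral_pushforward//; first exact: measurable_swap.
  exact: integrable_joint_law_swap ih.
by apply: eq_measure_integral => A mA _; exact: pushforward_swap_joint_law.
Qed.

End reversible_joint_law.

(** * Change of measure between [U] and a distribution with density [r] *)

Section density.
Context d (T : measurableType d) (R : realType).
Variables (U pi : probability T R) (r : T -> R).
Hypotheses (mr : measurable_fun setT r) (r0 : forall x, 0 <= r x).
Local Open Scope ereal_scope.
Hypothesis piE : forall A, measurable A -> pi A = \int[U]_(x in A) (r x)%:E.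

Lemma density_dominates : pi `<< U.
Proof.
apply/null_content_dominatesP => A mA UA0; rewrite piE//.
by apply: null_set_integral => //; apply: measurable_funTS; exact/measurable_EFinP.
Qed.

Lemma ae_density P : {ae U, forall x, P x} -> {ae pi, forall x, P x}.
Proof.
move=> [N [mN N0 PN]]; exists N; split => //.
by move/null_content_dominatesP : density_dominates; apply.
Qed.

(** Change of variables is known for the Radon-Nikodym derivative of [pi], and [r] agrees with it
    [U]-almost everywhere because both have the same integral over every measurable set. *)
Lemma ge0_integral_density (f : T -> \bar R) :
  measurable_fun setT f -> (forall x, 0 <= f x) ->
  \int[pi]_x f x = \int[U]_x (f x * (r x)%:E).
Proof.
move=> mf f0.
rewrite -(Radon_Nikodym_SigmaFinite.change_of_variables density_dominates)//.
have irn := Radon_Nikodym_SigmaFinite.f_integrable density_dominates.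
have mrn := measurable_int _ irn.
have mer : measurable_fun setT (EFin \o r) by exact/measurable_EFinP.
apply: ae_eq_integral => //; try exact: emeasurable_funM.
apply: ae_eqe_mul2l; apply: integral_ae_eq => // A _ mA.
by rewrite -Radon_Nikodym_SigmaFinite.f_integral//; [exact: piE|exact: density_dominates].
Qed.

(** The zero set of [r] has [pi]-mass zero, so dividing by [r x] is legitimate [pi]-almost
    everywhere. *)
Lemma ae_density_gt0 : {ae pi, forall x, (0 < r x)%R}.
Proof.
exists (r @^-1` [set 0%R]); split.
- by rewrite -[X in measurable X]setTI; exact: mr.
- rewrite piE; last by rewrite -[X in measurable X]setTI; exact: mr.
  by apply: integral0_eq => x /= ->.
- by move=> x /= /negP; rewrite lt_neqAle r0 andbT negbK => /eqP.
Qed.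

Lemma integrable_densityP (f : T -> R) : measurable_fun setT f ->
  pi.-integrable setT (EFin \o f) <->
  U.-integrable setT (fun x => (f x * r x)%:E).
Proof.
move=> mf.
have E : \int[pi]_x `|(f x)%:E| = \int[U]_x `|(f x * r x)%:E|.
  rewrite ge0_integral_density; last 2 first.
  - by apply: measurableT_comp => //; exact/measurable_EFinP.
  - by move=> x; exact: abse_ge0.
  by apply: eq_integral => x _; 
  rewrite EFinM abseM (@gee0_abs _ (r x)%:E) ?lee_fin.
split=> /integrableP[_ h]; apply/integrableP; split.
- by apply/measurable_EFinP; exact: measurable_funM.
- by rewrite -E.
- exact/measurable_EFinP.
- by rewrite E.
Qed.

Lemma integral_density (f : T -> R) : pi.-integrable setT (EFin \o f) ->
  \int[pi]_x (f x)%:E = \int[U]_x (f x * r x)%:E.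
Proof.
move=> pif; have mf : measurable_fun setT f.
  by apply/measurable_EFinP; exact: measurable_int pif.
have mef : measurable_fun setT (EFin \o f) by exact/measurable_EFinP.
rewrite integralE [RHS]integralE !ge0_integral_density//; last 2 first.
- exact: measurable_funeneg.
- exact: measurable_funepos.
have rE x : (0 <= (r x)%:E) by rewrite lee_fin.
by congr (_ - _); apply: eq_integral => x _;
  rewrite ?funeposE ?funenegE EFinM maxe_pMl ?mul0e ?mulNe.
Qed.

Lemma Rintegral_density (f : T -> R) : pi.-integrable setT (EFin \o f) ->
  (\int[pi]_x f x = \int[U]_x (f x * r x))%R.
Proof. by move=> pif; rewrite /Rintegral integral_density. Qed.

End density.

(** * Square integrability and a weighted Cauchy-Schwarz inequality *)

Lemma Lfun2P d (T : measurableType d) (R : realType)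
    (nu : {measure set T -> \bar R}) (f : T -> R) :
  f \in Lfun nu 2%:E <->
  measurable_fun setT f /\ nu.-integrable setT (fun x => (f x ^+ 2)%:E).
Proof.
split=> [lf|[mf /integrableP[_ intf]]].
  split; last exact: Lfun2_integrable_sqr.
  by move: lf; rewrite inE => /andP[]; rewrite inE.
(* The norm is a real power of the integral of [|f|] squared, so finiteness of that integral
   suffices. *)
rewrite inE; apply/andP; split; rewrite inE//= /finite_norm unlock poweR_lty//.
rewrite (eq_integral (fun x => `|(f x ^+ 2)%:E|)%E)// => x _.
by rewrite /= powR_mulrn// normrX.
Qed.

Section weighted_square.
Context d (T : measurableType d) (R : realType).
(* Not a [probability], so as to apply to the measures of a kernel. *)
Variables (P : {measure set T -> \bar R}) (g a : T -> R).
Hypothesis PT : P setT = 1%E.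
Hypotheses (mg : measurable_fun setT g) (ma : measurable_fun setT a).
Hypotheses (a0 : forall x, 0 <= a x) (a1 : forall x, a x <= 1).

Lemma integrable_cst_mass1 (c : R) : P.-integrable setT (EFin \o cst c).
Proof.
apply/integrableP; split; first exact/measurable_EFinP.
by under eq_integral do rewrite /=; rewrite integral_cst// PT mule1 ltry.
Qed.

Lemma Rintegral_cst_mass1 (c : R) : \int[P]_x c = c.
Proof. by rewrite Rintegral_cst// PT mulr1. Qed.

Lemma integrable_weight : P.-integrable setT (EFin \o a).
Proof.
apply: (le_integrable _ _ _ (integrable_cst_mass1 1)) => //.
  exact/measurable_EFinP.
by move=> x _; rewrite /= lee_fin !ger0_norm.
Qed.

(** Domination by [g^2 a + a]: expanding [(|g| - 1)^2 >= 0] gives [|g| <= g^2 + 1]. *)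
Lemma integrable_weighted :
  P.-integrable setT (fun x => (g x ^+ 2 * a x)%:E) ->
  P.-integrable setT (fun x => (g x * a x)%:E).
Proof.
move=> ig; have := integrableD measurableT ig integrable_weight.
apply: le_integrable => //.
  by apply/measurable_EFinP; exact: measurable_funM.
move=> x _; rewrite /= lee_fin normrM (ger0_norm (a0 x)).
rewrite [leRHS]ger0_norm; last by rewrite addr_ge0// mulr_ge0// sqr_ge0.
rewrite -(real_normK (num_real (g x))).
have := mulr_ge0 (sqr_ge0 (`|g x| - 1)) (a0 x).
have := mulr_ge0 (normr_ge0 (g x)) (a0 x); nra.
Qed.

(** Cauchy-Schwarz for a weight of total mass at most one. With [c] the integral of [g a], expanding
    [(g - c)^2 a >= 0] under the integral bounds the right-hand side below by [2 c^2 - c^2 * int a],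
    hence by [c^2]. *)
Lemma sqr_Rintegral_le :
  (((\int[P]_x (g x * a x)) ^+ 2)%:E <= \int[P]_x (g x ^+ 2 * a x)%:E)%E.
Proof.
have g2a0 x : 0 <= g x ^+ 2 * a x by rewrite mulr_ge0// sqr_ge0.
have mg2a : measurable_fun setT (fun x => g x ^+ 2 * a x).
  by apply: measurable_funM => //; exact: measurable_funX.
have [infty|fin] := eqVneq (\int[P]_x (g x ^+ 2 * a x)%:E)%E +oo%E.
  by rewrite infty leey.
have ig2 : P.-integrable setT (fun x => (g x ^+ 2 * a x)%:E).
  apply/integrableP; split; first exact/measurable_EFinP.
  under eq_integral do rewrite gee0_abs ?lee_fin//.
  by rewrite ltey.
have ig := integrable_weighted ig2; have ia := integrable_weight.
set c := \int[P]_x (g x * a x).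
have icg : P.-integrable setT (fun x => ((- 2 * c) * (g x * a x))%:E).
  exact: (integrableZl measurableT (- 2 * c) ig).
have ica : P.-integrable setT (fun x => (c ^+ 2 * a x)%:E).
  exact: (integrableZl measurableT (c ^+ 2) ia).
have : 0 <= \int[P]_x ((g x - c) ^+ 2 * a x).
  by apply: Rintegral_ge0 => x _; rewrite mulr_ge0// sqr_ge0.
rewrite (_ : \int[P]_x ((g x - c) ^+ 2 * a x) =
    \int[P]_x (g x ^+ 2 * a x + (- 2 * c) * (g x * a x) + c ^+ 2 * a x)); last first.
  by apply: eq_Rintegral => x _; ring.
have igc := integrableD measurableT ig2 icg.
rewrite RintegralD// RintegralD// !RintegralZl// -/c.
have a1' : \int[P]_x a x <= 1.
  rewrite -[leRHS](Rintegral_cst_mass1 1).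
  by apply: le_Rintegral => //; exact: integrable_cst_mass1.
move=> h; rewrite -(fineK (integrable_fin_num measurableT ig2)) lee_fin.
rewrite -/(Rintegral _ _ _); have := sqr_ge0 c.
set I := \int[P]_x (g x ^+ 2 * a x) in h *; nra.
Qed.

End weighted_square.

(** * The acceptance probability *)

Section acceptance.
Context d (T : measurableType d) (R : realType) (r : T -> R).
Hypothesis r0 : forall x, 0 <= r x.

Lemma acceptance_ge0 x y : 0 <= acceptance r x y.
Proof. by rewrite /acceptance le_min ler01 divr_ge0. Qed.

Lemma acceptance_le1 x y : acceptance r x y <= 1.
Proof. by rewrite /acceptance ge_min lexx. Qed.

(** Detailed balance: weighting by the density at [x] makes the acceptance probability symmetric in
    [x] and [y]. Where [r x = 0] both sides vanish, since [r y >= 0]. *)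
Lemma acceptanceM x y : acceptance r x y * r x = Num.min (r x) (r y).
Proof.
rewrite /acceptance minr_pMl// mul1r.
have [rx|rx] := eqVneq (r x) 0; last by rewrite divfK.
by rewrite rx mulr0 minxx; apply/esym/min_idPl.
Qed.

Lemma measurable_acceptance : measurable_fun setT r ->
  measurable_fun setT (fun z : T * T => acceptance r z.1 z.2).
Proof.
move=> mr; apply: measurable_minr => //; apply: measurable_funM.
  by apply: measurableT_comp => //; exact: measurable_snd.
(* The reciprocal is replaced by the real power [-1], known to be measurable. The two agree on
   nonnegative numbers, including [0], where both are [0]. *)
rewrite (_ : (fun z => _) = (fun x => x `^ (-1)) \o (r \o fst)).
  apply: measurableT_comp; first exact: measurable_powR.
  by apply: measurableT_comp => //; exact: measurable_fst.
by apply/funext => z /=; rewrite powR_inv1.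
Qed.

End acceptance.

(** * The Metropolis operator of a density [r]: boundedness and linearity on [L2] *)

Section metropolis.
Context d (T : measurableType d) (R : realType).
Variables (U pi : probability T R) (B : R.-pker T ~> T) (r : T -> R).
Hypotheses (mr : measurable_fun setT r) (r0 : forall x, 0 <= r x).
Hypothesis piE : forall A, measurable A ->
  pi A = (\int[U]_(x in A) (r x)%:E)%E.
Hypothesis rev : reversible B U.
Local Notation m := (joint_law U B).
Local Notation L2 := (Lfun pi 2%:E).

(** Density, with respect to the joint law, of the accepted moves started from [pi]; see
    [acceptanceM]. *)
Definition flow (z : T * T) : R := Num.min (r z.1) (r z.2).

Definition accepted_op (f : T -> R) (x : T) : R :=
  \int[B x]_y (f y * acceptance r x y).

Definition rejection (x : T) : R := 1 - \int[B x]_y acceptance r x y.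

Lemma flow_ge0 z : 0 <= flow z.
Proof. by rewrite /flow le_min !r0. Qed.

Lemma measurable_flow : measurable_fun setT flow.
Proof.
by apply: measurable_minr; apply: measurableT_comp.
Qed.

Lemma measurable_acceptance_section x :
  measurable_fun setT (acceptance r x).
Proof. exact: (measurable_fun_pair2 x (measurable_acceptance r0 mr)). Qed.

Lemma measurable_accepted_op f : measurable_fun setT f ->
  measurable_fun setT (accepted_op f).
Proof.
move=> mf; apply: (@measurable_kernel_Rintegral _ _ _ _ _ B
  (fun z => f z.2 * acceptance r z.1 z.2)).
apply: measurable_funM; last exact: measurable_acceptance.
exact: measurableT_comp.
Qed.

Lemma measurable_rejection : measurable_fun setT rejection.
Proof.
apply: measurable_funB => //.
apply: (@measurable_kernel_Rintegral _ _ _ _ _ B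
  (fun z => acceptance r z.1 z.2)).
exact: measurable_acceptance.
Qed.

Lemma integrable_acceptance x :
  (B x).-integrable setT (fun y => (acceptance r x y)%:E).
Proof.
apply: integrable_weight => //; first exact: prob_kernel.
- exact: measurable_acceptance_section.
- exact: acceptance_ge0.
- exact: acceptance_le1.
Qed.

Lemma rejection_ge0 x : 0 <= rejection x.
Proof.
rewrite subr_ge0 -[leRHS](Rintegral_cst_mass1 (@prob_kernel _ _ _ _ _ B x)).
apply: le_Rintegral => //.
- exact: integrable_acceptance.
- exact: integrable_cst_mass1 (@prob_kernel _ _ _ _ _ B x) 1.
- by move=> y _; exact: acceptance_le1.
Qed.

Lemma rejection_le1 x : rejection x <= 1.
Proof.
by rewrite gerBl Rintegral_ge0// => y _; exact: acceptance_ge0.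
Qed.

(** Exchanging the coordinates moves [f] to the starting point; there the flow is at most [r x], and
    [B x] has mass one. *)
Lemma integral_sqr_flow_le (f : T -> R) : measurable_fun setT f ->
  (\int[m]_z (f z.2 ^+ 2 * flow z)%:E <= \int[pi]_x (f x ^+ 2)%:E)%E.
Proof.
move=> mf.
have mf2 : measurable_fun setT (fun z : T * T => (f z.1 ^+ 2 * flow z)%:E).
  apply/measurable_EFinP/measurable_funM; last exact: measurable_flow.
  by apply/measurable_funX/measurableT_comp.
have f20 z : (0 <= (f z.1 ^+ 2 * flow z)%:E)%E.
  by rewrite lee_fin mulr_ge0 ?sqr_ge0 ?flow_ge0.
under eq_integral => z _ do rewrite /flow minC.
rewrite (ge0_integral_joint_law_swap rev mf2 f20) ge0_integral_joint_law//.
rewrite (ge0_integral_density mr piE)//; last 2 first.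
- by apply/measurable_EFinP/measurable_funX.
- by move=> x; rewrite lee_fin sqr_ge0.
apply: ge0_le_integral => //.
- by move=> x _; apply: integral_ge0.
- exact: (measurable_kernel_integral B mf2 f20).
- by apply: emeasurable_funM; apply/measurable_EFinP => //; exact: measurable_funX.
move=> x _; rewrite -[leRHS](_ : \int[B x]_y (f x ^+ 2 * r x)%:E = _)%E; last first.
  by rewrite integral_cst// prob_kernel mule1.
apply: ge0_le_integral => //.
  exact: (measurable_fun_pair2 x mf2).
move=> y _; rewrite lee_fin ler_wpM2l ?sqr_ge0//.
by rewrite /flow ge_min lexx.
Qed.

Lemma integrable_sqr_flow2 f : f \in L2 ->
  m.-integrable setT (fun z => (f z.2 ^+ 2 * flow z)%:E).
Proof.
move=> /Lfun2P[mf if2]; apply/integrableP; split.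
  apply/measurable_EFinP/measurable_funM; last exact: measurable_flow.
  by apply/measurable_funX/measurableT_comp.
have f20 z : (0 <= (f z.2 ^+ 2 * flow z)%:E)%E.
  by rewrite lee_fin mulr_ge0 ?sqr_ge0 ?flow_ge0.
under eq_integral => z _ do rewrite gee0_abs//.
exact: le_lt_trans (integral_sqr_flow_le mf) (integrable_lty _ if2).
Qed.

Lemma integrable_sqr_flow1 f : f \in L2 ->
  m.-integrable setT (fun z => (f z.1 ^+ 2 * flow z)%:E).
Proof.
move=> /integrable_sqr_flow2 /(integrable_joint_law_swap rev).
by apply: eq_integrable => // z _ /=; rewrite /flow/= minC.
Qed.

(** Domination by the two square integrals, using [|a b| <= a^2 + b^2]. *)
Lemma integrable_flow f g : f \in L2 -> g \in L2 ->
  m.-integrable setT (fun z => (f z.2 * g z.1 * flow z)%:E).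
Proof.
move=> Lf Lg; have /Lfun2P[mf _] := Lf; have /Lfun2P[mg _] := Lg.
have := integrableD measurableT (integrable_sqr_flow2 Lf) (integrable_sqr_flow1 Lg).
apply: le_integrable => //.
  apply/measurable_EFinP/measurable_funM; last exact: measurable_flow.
  by apply: measurable_funM; apply: measurableT_comp.
move=> z _; rewrite /= lee_fin -mulrDl !normrM (ger0_norm (flow_ge0 z)).
rewrite ler_wpM2r ?flow_ge0// [leRHS]ger0_norm ?addr_ge0 ?sqr_ge0//.
rewrite -(real_normK (num_real (f z.2))) -(real_normK (num_real (g z.1))).
have := sqr_ge0 (`|f z.2| - `|g z.1|).
have := mulr_ge0 (normr_ge0 (f z.2)) (normr_ge0 (g z.1)); nra.
Qed.

Lemma cst_L2 (c : R) : cst c \in L2.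
Proof. exact: Lfun_cst. Qed.

Lemma ae_integrable_flow f : f \in L2 ->
  {ae U, forall x, (B x).-integrable setT (fun y => (f y * flow (x, y))%:E)}.
Proof.
(* The constant [1] belongs to [L2] because [pi] is a probability, so it can serve as second
   factor. *)
move=> Lf; have := ae_integrable_joint_law (integrable_flow Lf (cst_L2 1)).
apply: filterS => x; apply: eq_integrable => // y _ /=.
by rewrite mulr1.
Qed.

Lemma integrable_accepted f x : r x != 0 ->
  (B x).-integrable setT (fun y => (f y * flow (x, y))%:E) ->
  (B x).-integrable setT (fun y => (f y * acceptance r x y)%:E).
Proof.
move=> rx /(integrableZl measurableT (r x)^-1).
apply: eq_integrable => // y _ /=; rewrite -EFinM /flow/= -acceptanceM//.
by rewrite mulrC -!mulrA divff// mulr1.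
Qed.

Lemma ae_integrable_accepted f : f \in L2 ->
  {ae pi, forall x, (B x).-integrable setT
    (fun y => (f y * acceptance r x y)%:E)}.
Proof.
move=> /ae_integrable_flow /(ae_density mr piE).
apply: filterS2 (ae_density_gt0 mr r0 piE) => x rx.
by apply: integrable_accepted; rewrite gt_eqF.
Qed.

(** The weighted Cauchy-Schwarz inequality is applied under each [B x]; multiplying by [r x] turns
    the acceptance probability into the flow, which [integral_sqr_flow_le] controls. *)
Lemma sqr_accepted_op_le (f : T -> R) : measurable_fun setT f ->
  (\int[pi]_x (accepted_op f x ^+ 2)%:E <= \int[pi]_x (f x ^+ 2)%:E)%E.
Proof.
move=> mf; apply: le_trans (integral_sqr_flow_le mf).
have mA := measurable_accepted_op mf.
have mf2 : measurable_fun setT (fun z => (f z.2 ^+ 2 * flow z)%:E).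
  apply/measurable_EFinP/measurable_funM; last exact: measurable_flow.
  by apply/measurable_funX/measurableT_comp.
rewrite (ge0_integral_density mr piE); last 2 first.
- by apply/measurable_EFinP/measurable_funX.
- by move=> x; rewrite lee_fin sqr_ge0.
rewrite ge0_integral_joint_law//; last first.
  by move=> z; rewrite lee_fin mulr_ge0 ?sqr_ge0 ?flow_ge0.
apply: ge0_le_integral => //.
- by move=> x _; rewrite mule_ge0 ?lee_fin ?sqr_ge0.
- by apply: emeasurable_funM; apply/measurable_EFinP => //; exact: measurable_funX.
- apply: (measurable_kernel_integral B mf2) => z.
  by rewrite lee_fin mulr_ge0 ?sqr_ge0 ?flow_ge0.
move=> x _; have ma := measurable_acceptance_section x.
apply: (@le_trans _ _
  ((\int[B x]_y (f y ^+ 2 * acceptance r x y)%:E) * (r x)%:E))%E.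
  rewrite lee_wpmul2r ?lee_fin//; apply: sqr_Rintegral_le => //.
    exact: prob_kernel.
    exact: acceptance_ge0.
  exact: acceptance_le1.
rewrite muleC -ge0_integralZl//.
- rewrite le_eqVlt; apply/orP; left; apply/eqP/eq_integral => y _.
  by rewrite -EFinM /flow/= -acceptanceM// mulrC -mulrA.
- by apply/measurable_EFinP/measurable_funM => //; exact: measurable_funX.
- by move=> y _; rewrite lee_fin mulr_ge0 ?sqr_ge0 ?acceptance_ge0.
- by rewrite lee_fin.
Qed.

Lemma metropolis_opE f x :
  metropolis_op r B f x = accepted_op f x + rejection x * f x.
Proof. by []. Qed.

Lemma measurable_metropolis_op f : measurable_fun setT f ->
  measurable_fun setT (metropolis_op r B f).
Proof.
move=> mf; apply: measurable_funD; first exact: measurable_accepted_op.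
by apply: measurable_funM => //; exact: measurable_rejection.
Qed.

(** The constant comes from [(a + b)^2 <= 2 a^2 + 2 b^2], where the accepted and the rejected part
    each have square integral at most that of [f]. *)
Lemma sqr_metropolis_op_le (f : T -> R) : measurable_fun setT f ->
  (\int[pi]_x (metropolis_op r B f x ^+ 2)%:E <=
   4%:E * \int[pi]_x (f x ^+ 2)%:E)%E.
Proof.
move=> mf; have mA := measurable_accepted_op mf.
have mA2 : measurable_fun setT (fun x => (2 * accepted_op f x ^+ 2)%:E).
  by apply/measurable_EFinP/measurable_funM => //; exact: measurable_funX.
have mf2 : measurable_fun setT (fun x => (2 * f x ^+ 2)%:E).
  by apply/measurable_EFinP/measurable_funM => //; exact: measurable_funX.
have ge02 (a : R) : (0 <= (2 * a ^+ 2)%:E)%E by rewrite lee_fin mulr_ge0 ?sqr_ge0.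
apply: (@le_trans _ _
  (\int[pi]_x ((2 * accepted_op f x ^+ 2)%:E + (2 * f x ^+ 2)%:E))%E).
  apply: ge0_le_integral => //.
  - by move=> x _; rewrite lee_fin sqr_ge0.
  - by apply/measurable_EFinP/measurable_funX; exact: measurable_metropolis_op.
  - exact: emeasurable_funD.
  move=> x _; rewrite metropolis_opE -EFinD lee_fin.
  have h : (rejection x * f x) ^+ 2 <= f x ^+ 2.
    rewrite exprMn ler_piMl ?sqr_ge0// exprn_ile1 ?rejection_ge0//.
    exact: rejection_le1.
  have := sqr_ge0 (accepted_op f x - rejection x * f x).
  move: h; set b := rejection x * f x; nra.
rewrite ge0_integralD//.
under eq_integral do rewrite EFinM.
rewrite ge0_integralZl_EFin//; last 2 first.
- by move=> x _; rewrite lee_fin sqr_ge0.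
- by apply/measurable_EFinP/measurable_funX.
under [X in (_ + X)%E]eq_integral do rewrite EFinM.
rewrite ge0_integralZl_EFin//; last 2 first.
- by move=> x _; rewrite lee_fin sqr_ge0.
- by apply/measurable_EFinP/measurable_funX.
have -> : (4%:E = 2%:E + 2%:E :> \bar R)%E by rewrite -EFinD; congr EFin; ring.
rewrite [leRHS]ge0_muleDl ?lee_fin//.
apply: leeD => //; rewrite lee_wpmul2l ?lee_fin//.
exact: sqr_accepted_op_le.
Qed.

Lemma Lfun2_of_sqr_le (f g : T -> R) c : f \in L2 -> measurable_fun setT g ->
  (\int[pi]_x (g x ^+ 2)%:E <= c%:E * \int[pi]_x (f x ^+ 2)%:E)%E -> g \in L2.
Proof.
move=> /Lfun2P[_ if2] mg gf; apply/Lfun2P; split => //.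
apply/integrableP; split; first by apply/measurable_EFinP/measurable_funX.
under eq_integral => x _ do rewrite gee0_abs ?lee_fin ?sqr_ge0//.
apply: le_lt_trans gf _.
by rewrite ltey_eq fin_numM//; exact: integrable_fin_num if2.
Qed.

Lemma accepted_op_L2 f : f \in L2 -> accepted_op f \in L2.
Proof.
move=> Lf; have /Lfun2P[mf _] := Lf.
apply: (@Lfun2_of_sqr_le f _ 1) => //; first exact: measurable_accepted_op.
by rewrite mul1e; exact: sqr_accepted_op_le.
Qed.

Lemma metropolis_op_L2 f : f \in L2 -> metropolis_op r B f \in L2.
Proof.
move=> Lf; have /Lfun2P[mf _] := Lf.
apply: (Lfun2_of_sqr_le Lf (measurable_metropolis_op mf)).
exact: sqr_metropolis_op_le.
Qed.

(** The integral under [B x] can be split where both sections are integrable, which is the case for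
    [pi]-almost every [x]. *)
Lemma metropolis_op_linear c f g : f \in L2 -> g \in L2 ->
  {ae pi, forall x, metropolis_op r B (fun y => c * f y + g y) x =
    c * metropolis_op r B f x + metropolis_op r B g x}.
Proof.
move=> /ae_integrable_accepted + /ae_integrable_accepted.
apply: filterS2 => x fi gi; rewrite !metropolis_opE /accepted_op.
rewrite (@eq_Rintegral _ _ _ _ _ (fun y => c * (f y * acceptance r x y) +
    g y * acceptance r x y)); last by move=> y _; ring.
rewrite RintegralD ?RintegralZl//; last exact: integrableZl fi.
by ring.
Qed.

(** The difference of [f] and [g] has square integral zero, so by the norm bound its image vanishes
    almost everywhere; linearity concludes. *)
Lemma metropolis_op_ae_eq f g : f \in L2 -> g \in L2 ->
  {ae pi, forall x, f x = g x} ->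
  {ae pi, forall x, metropolis_op r B f x = metropolis_op r B g x}.
Proof.
move=> Lf Lg fg; have /Lfun2P[mf _] := Lf; have /Lfun2P[mg _] := Lg.
(* The difference is written in the form [c * g + f] of [metropolis_op_linear]. *)
pose h y := -1 * g y + f y.
have mh : measurable_fun setT h by apply: measurable_funD => //; exact: measurable_funM.
have mM := measurable_metropolis_op mh.
have h0 : (\int[pi]_x (h x ^+ 2)%:E = 0)%E.
  rewrite (ae_eq_integral (cst 0%E)) ?integral0//.
    by apply/measurable_EFinP/measurable_funX.
  apply: filterS fg => x /= fgx _.
  by rewrite /h fgx mulN1r addNr expr0n.
have M0 : (\int[pi]_x `|(metropolis_op r B h x ^+ 2)%:E| = 0)%E.
  apply/eqP; rewrite eq_le integral_ge0// andbT.
  have := sqr_metropolis_op_le mh; rewrite h0 mule0; apply: le_trans.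
  by rewrite le_eqVlt; apply/orP; left; apply/eqP/eq_integral => x _;
    rewrite gee0_abs// lee_fin sqr_ge0.
have mM2 : measurable_fun setT (fun x => (metropolis_op r B h x ^+ 2)%:E).
  by apply/measurable_EFinP/measurable_funX.
have M0ae := (ae_eq_integral_abs pi measurableT mM2).1 M0.
apply: filterS2 (metropolis_op_linear (-1) Lg Lf) M0ae => x.
move=> -> /(_ I) [] /eqP.
by rewrite sqrf_eq0 mulN1r addrC subr_eq0 => /eqP.
Qed.

(** * The bilinear form of the Metropolis operator and self-adjointness *)

Lemma accepted_op_density f x :
  (B x).-integrable setT (fun y => (f y * flow (x, y))%:E) ->
  accepted_op f x * r x = \int[B x]_y (f y * flow (x, y)).
Proof.
(* Where [r x = 0] the flow out of [x] vanishes too, so both sides are zero. *)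
move=> fi; have [rx|rx] := eqVneq (r x) 0.
  rewrite rx mulr0 (@eq_Rintegral _ _ _ _ _ (cst 0)) ?Rintegral_cst ?mul0r//.
  by move=> y _; rewrite /flow/= rx (min_idPl (r0 y)) mulr0.
rewrite -RintegralZr//; last exact: integrable_accepted.
by apply: eq_Rintegral => y _; rewrite /flow/= -acceptanceM// mulrA.
Qed.

(** Writing [pi] as [r] times [U] brings the density next to the acceptance probability; the
    resulting iterated integral is one over the joint law. *)
Lemma inner_accepted_op f g : f \in L2 -> g \in L2 ->
  L2_inner pi (accepted_op f) g = \int[m]_z (f z.2 * g z.1 * flow z).
Proof.
move=> Lf Lg; have /Lfun2P[mf _] := Lf; have /Lfun2P[mg _] := Lg.
have LA := accepted_op_L2 Lf; have /Lfun2P[mA _] := LA.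
have /Lfun1_integrable iAg := Lfun2_mul_Lfun1 LA Lg.
rewrite /L2_inner (Rintegral_density mr r0 piE iAg).
have ifg := integrable_flow Lf Lg.
rewrite Rintegral_joint_law//; congr fine; apply: ae_eq_integral => //.
- apply/measurable_EFinP/measurable_funM => //; exact: measurable_funM.
- apply/measurable_EFinP; apply: (@measurable_kernel_Rintegral _ _ _ _ _ B
    (fun z => f z.2 * g z.1 * flow z)).
  by apply/measurable_EFinP; exact: measurable_int ifg.
apply: filterS (ae_integrable_flow Lf) => x fi _ /=; congr EFin.
rewrite mulrAC accepted_op_density// -RintegralZr//.
by apply: eq_Rintegral => y _; rewrite mulrAC.
Qed.

Lemma inner_metropolis_op f g : f \in L2 -> g \in L2 ->
  L2_inner pi (metropolis_op r B f) g =
  \int[m]_z (f z.2 * g z.1 * flow z) + \int[pi]_x (rejection x * (f x * g x)).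
Proof.
move=> Lf Lg; rewrite -inner_accepted_op// /L2_inner.
have /Lfun1_integrable ifg := Lfun2_mul_Lfun1 Lf Lg.
have /Lfun1_integrable iAg := Lfun2_mul_Lfun1 (accepted_op_L2 Lf) Lg.
rewrite -RintegralD//.
  by apply: eq_Rintegral => x _; rewrite metropolis_opE mulrDl mulrA.
apply: le_integrable ifg => //.
  have /Lfun2P[mf _] := Lf; have /Lfun2P[mg _] := Lg.
  apply/measurable_EFinP/measurable_funM; first exact: measurable_rejection.
  exact: measurable_funM.
move=> x _; rewrite /= lee_fin normrM ler_piMl// ger0_norm ?rejection_ge0//.
exact: rejection_le1.
Qed.

Lemma metropolis_op_self_adjoint : L2_self_adjoint pi (metropolis_op r B).
Proof.
move=> f g Lf Lg.
rewrite (_ : L2_inner pi f _ = L2_inner pi (metropolis_op r B g) f); last first.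
  by apply: eq_Rintegral => x _; rewrite mulrC.
rewrite !inner_metropolis_op//; congr (_ + _); last first.
  by apply: eq_Rintegral => x _; rewrite (mulrC (f x)).
(* Exchanging the coordinates swaps the roles of [f] and [g] and leaves the flow unchanged. *)
rewrite -(Rintegral_joint_law_swap rev); last exact: integrable_flow.
by apply: eq_Rintegral => z _; rewrite /flow/= minC (mulrC (f _)).
Qed.

Lemma metropolis_op_operator : L2_operator pi (metropolis_op r B).
Proof.
split; [exact: metropolis_op_L2|exact: metropolis_op_ae_eq|].
by move=> c f g; exact: metropolis_op_linear.
Qed.

End metropolis.

(** * Positivity by the layer-cake decomposition of the flow *)

Section positivity.
Context d (T : measurableType d) (R : realType).
Variables (U : probability T R) (B : R.-pker T ~> T).
Hypotheses (rev : reversible B U) (Bpos : L2_positive U (markov_op B)).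
Local Notation m := (joint_law U B).

Let flow1 (z : T * T) : flow (cst 1 : T -> R) z = 1.
Proof. by rewrite /flow minxx. Qed.

(** [U] has density one with respect to itself, so the results on the Metropolis operator can be
    specialized to [B]. *)
Let density1 A : measurable A -> U A = (\int[U]_(x in A) (1%R : R)%:E)%E.
Proof. by move=> mA; rewrite integral_cst// mul1e. Qed.

Lemma integrable_joint_law_prod f : f \in Lfun U 2%:E ->
  m.-integrable setT (fun z => (f z.2 * f z.1)%:E).
Proof.
move=> Lf; have := integrable_flow (measurable_cst (1 : R))
  (fun=> ler01) density1 rev Lf Lf.
by apply: eq_integrable => // z _; rewrite flow1 mulr1.
Qed.

(* The Metropolis operator of the constant density is [markov_op B] itself. *)
Lemma integral_joint_law_prod_ge0 f : f \in Lfun U 2%:E ->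
  0 <= \int[m]_z (f z.2 * f z.1).
Proof.
move=> Lf; have := Bpos Lf.
rewrite (_ : markov_op B f = accepted_op B (cst 1) f); last first.
  apply/funext => x; apply: eq_Rintegral => y _.
  by rewrite /acceptance divr1 minxx mulr1.
rewrite (inner_accepted_op (measurable_cst _) (fun=> ler01) density1 rev Lf Lf).
by under eq_Rintegral => z _ do rewrite flow1 mulr1.
Qed.

Variables (pi : probability T R) (r : T -> R).
Hypotheses (mr : measurable_fun setT r) (r0 : forall x, 0 <= r x).
Hypothesis piE : forall A, measurable A ->
  pi A = (\int[U]_(x in A) (r x)%:E)%E.

Definition superlevel (f : T -> R) (t : R) (x : T) : R :=
  if t < r x then f x else 0.

(** Where [t < r x] one has [1 <= r x / t], so the truncated square is at most [t^-1 f^2 r], which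
    is [U]-integrable by the change of measure. *)
Lemma superlevel_L2 f t : 0 < t -> f \in Lfun pi 2%:E ->
  superlevel f t \in Lfun U 2%:E.
Proof.
move=> t0 /Lfun2P[mf if2].
have mft : measurable_fun setT (superlevel f t).
  apply: measurable_fun_ifT => //.
  by apply: measurable_fun_ltr => //; exact: measurable_cst.
apply/Lfun2P; split => //.
have := integrableZl measurableT t^-1
  ((integrable_densityP mr r0 piE (measurable_funX 2 mf)).1 if2).
apply: le_integrable => //.
  by apply/measurable_EFinP/measurable_funX.
move=> x _; rewrite /= lee_fin ger0_norm ?sqr_ge0//.
have h0 : 0 <= t^-1 * (f x ^+ 2 * r x).
  by rewrite mulr_ge0 ?invr_ge0 ?(ltW t0)// mulr_ge0 ?sqr_ge0.
rewrite ger0_norm// /superlevel; case: ifPn => [tr|_]; last by rewrite expr0n.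
by rewrite mulrCA ler_peMr ?sqr_ge0// ler_pdivlMl// mulr1 ltW.
Qed.

Lemma integral_flow_ge0 f : f \in Lfun pi 2%:E ->
  0 <= \int[m]_z (f z.2 * f z.1 * flow r z).
Proof.
move=> Lf; have /Lfun2P[mf _] := Lf.
have iflow := integrable_flow mr r0 piE rev Lf Lf.
(* Layer cake: [flow r z] is the length of the set of [t > 0] below both
   [r z.1] and [r z.2]. *)
pose h (p : (T * T) * measurableTypeR R) : \bar R :=
  (superlevel f p.2 p.1.2 * superlevel f p.2 p.1.1 * \1_`]0, +oo[%classic p.2)%:E.
(* The two truncations and [0 < t] combine into [0 < t < flow r z], as lying below a minimum means
   lying below both terms. *)
have hE z t : h (z, t) =
    ((f z.2 * f z.1)%:E * (\1_`]0%R, flow r z[%classic t)%:E)%E.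
  rewrite /h/= /superlevel -EFinM; congr EFin.
  rewrite !indicE !mem_setE !in_itv/= andbT /flow lt_min.
  by case: (t < r z.2); case: (t < r z.1); case: (0 < t);
    rewrite /= ?mulr0 ?mul0r ?mulr1.
have mh : measurable_fun setT h.
  have ms (u : (T * T) * measurableTypeR R -> T) : measurable_fun setT u ->
      measurable_fun setT (fun p => superlevel f p.2 (u p)).
    move=> mu; apply: measurable_fun_ifT => //.
      by apply: measurable_fun_ltr; [exact: measurable_snd|exact: measurableT_comp].
    exact: measurableT_comp.
  apply/measurable_EFinP/measurable_funM; first apply: measurable_funM.
  - by apply: ms; exact: measurableT_comp.
  - by apply: ms; exact: measurableT_comp.
  - apply: measurableT_comp => //.
have intZ c z : (\int[lebesgue_measure]_t
    (c%:E * (\1_`]0%R, flow r z[%classic t)%:E) = (c * flow r z)%:E)%E.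
  rewrite integralZl//; last exact: (integrable_indic_itv 0 (flow r z) false true).
  rewrite integral_indic// setIT EFinM; congr (_ * _)%E.
  have /= -> := @lebesgue_measure_itv R `]0, flow r z[.
  rewrite lte_fin; have := flow_ge0 r0 z.
  by case: ltgtP => // [_ _|<- _]; rewrite ?oppr0 ?adde0.
(* Integrating [|h|] over [t] first gives [|f f|] times the flow, integrable by [iflow]; this
   justifies Fubini for the signed [h]. *)
have ih : (m \x (@lebesgue_measure R))%E.-integrable setT h.
  apply/integrable12ltyP => //.
  rewrite (eq_integral (fun z => `|(f z.2 * f z.1 * flow r z)%:E|)%E).
    by have /integrableP[] := iflow.
  move=> z _; rewrite EFinM abseM (@gee0_abs _ (flow r z)%:E) ?lee_fin ?flow_ge0//.
  rewrite abse_EFin -EFinM -intZ; apply: eq_integral => t _.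
  by rewrite hE abseM (@gee0_abs _ (\1_ _ t)%:E)// lee_fin.
apply: fine_ge0; rewrite -(eq_integral _ _ (fun z _ => intZ _ z)).
under eq_integral => z _ do under eq_integral => t _ do rewrite -hE.
rewrite (Fubini ih); apply: integral_ge0 => t _.
(* For [t <= 0] the indicator in [h] is zero. For [t > 0] the truncation is in [L2] of [U], and
   positivity of [B] applies to it. *)
have [t0|t0] := ltP 0 t; last first.
  rewrite integral0_eq// => z _; rewrite /h/= indicE mem_setE in_itv/= andbT.
  by rewrite ltNge t0/= mulr0.
have Lft := superlevel_L2 t0 Lf.
have := integral_joint_law_prod_ge0 Lft; rewrite -lee_fin fineK; last first.
  exact: integrable_fin_num (integrable_joint_law_prod Lft).
rewrite (eq_integral (fun z => h (z, t)))// => z _.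
by rewrite /h/= indicE mem_setE in_itv/= t0 mulr1.
Qed.

Lemma metropolis_op_positive : L2_positive pi (metropolis_op r B).
Proof.
move=> f Lf; rewrite (inner_metropolis_op mr r0 piE rev Lf Lf).
rewrite addr_ge0 ?integral_flow_ge0//; apply: Rintegral_ge0 => x _.
by rewrite mulr_ge0 ?(rejection_ge0 _ mr r0)// -expr2 sqr_ge0.
Qed.

End positivity.

(** * Normalization of [rho], and the theorem *)

Lemma acceptance_scale (R : realType) d (T : measurableType d) (rho : T -> R)
    (c : R) : c != 0 ->
  acceptance (fun x => c * rho x) = acceptance rho.
Proof.
move=> c0; apply/funext => x; apply/funext => y.
by rewrite /acceptance -mulf_div divff// mul1r.
Qed.

Lemma metropolis_op_scale (R : realType) d (T : measurableType d)
    (B : R.-pker T ~> T) (rho : T -> R) (c : R) : c != 0 ->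
  metropolis_op (fun x => c * rho x) B = metropolis_op rho B.
Proof. by move=> c0; rewrite /metropolis_op acceptance_scale. Qed.

Lemma normalized_density d (T : measurableType d) (R : realType)
    (mu : {measure set T -> \bar R}) (U pi : probability T R) (rho : T -> R) :
  (forall x, 0 <= rho x) -> mu.-integrable setT (EFin \o rho) ->
  0 < \int[mu]_x rho x ->
  (forall A, measurable A -> U A = mu A / mu setT)%E ->
  (forall A, measurable A ->
     pi A = \int[mu]_(x in A) (rho x)%:E / \int[mu]_x (rho x)%:E)%E ->
  exists2 c, 0 < c &
    forall A, measurable A -> pi A = (\int[U]_(x in A) (c * rho x)%:E)%E.
Proof.
move=> rho0 irho Z0 UE piE.
have mrho : measurable_fun setT (EFin \o rho) := measurable_int _ irho.
(* A total mass of [0] or [+oo] would make the quotient [mu setT / mu setT] evaluate to [0], whereas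
   it equals [U setT = 1]. *)
have [v v0 vE] : exists2 v : R, 0 < v & mu setT = v%:E.
  have V0 : (0 <= mu setT)%E by exact: measure_ge0.
  have := UE setT measurableT; rewrite probability_setT.
  move: V0; case: (mu setT) => [v| |]//.
    rewrite lee_fin le_eqVlt => /predU1P[<-|v0 _]; last by exists v.
    by rewrite mul0e => /eqP; rewrite onee_eq0.
  by rewrite invey mule0 => _ /eqP; rewrite onee_eq0.
have muE A : measurable A -> mu A = mscale (NngNum (ltW v0)) U A.
  move=> mA; rewrite /mscale/= UE// vE inver gt_eqF// muleCA.
  by rewrite -EFinM divff ?gt_eqF// mule1.
set Z := \int[mu]_x rho x in Z0.
have ZE : (\int[mu]_x (rho x)%:E = Z%:E)%E.
  by rewrite fineK//; exact: integrable_fin_num irho.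
(* Since [mu] is [v] times [U], the density [rho / Z] with respect to [mu] becomes [v / Z * rho]
   with respect to [U]. *)
exists (v / Z) => [|A mA]; first exact: divr_gt0.
rewrite piE// ZE inver gt_eqF//.
rewrite (eq_measure_integral (mscale (NngNum (ltW v0)) U)); last first.
  by move=> A' mA' _; exact: muE.
have mrhoA : measurable_fun A (fun x => (rho x)%:E) by exact: measurable_funTS.
rewrite ge0_integral_mscale//=; last by move=> x _; rewrite lee_fin.
rewrite muleAC -EFinM -ge0_integralZl_EFin//.
- by move=> x _; rewrite lee_fin.
- by rewrite divr_ge0 ?ltW.
Qed.

Theorem mainTheorem2 (R : realType) (d : nat) (K : set 'rV[R]_d)
    (mK : measurable K) (bK : bounded_set K) (iK : K° !=set0)
    (rho : trace_type (nonempty_interior iK) -> R)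
    (rho_ge0 : forall x, 0 <= rho x)
    (rho_int : (trace_measure (lebesgue_rV R d) mK)
       .-integrable setT (EFin \o rho))
    (rho_gt0 :
       0 < \int[trace_measure (lebesgue_rV R d) mK]_x
             rho x)
    (pi : probability (trace_type (nonempty_interior iK)) R)
    (piE : forall A, measurable A ->
       (pi A =
        \int[trace_measure (lebesgue_rV R d) mK]_(x in A)
          (rho x)%:E /
        \int[trace_measure (lebesgue_rV R d) mK]_x
          (rho x)%:E)%E)
    (U0 : probability (trace_type (nonempty_interior iK)) R)
    (U0E : forall A, measurable A ->
       (U0 A = lebesgue_rV R d (trace_val @` A) / lebesgue_rV R d K)%E)
    (B : R.-pker (trace_type (nonempty_interior iK)) ~>
                 (trace_type (nonempty_interior iK)))
    (B_rev : reversible B U0)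
    (B_pos : L2_positive U0 (markov_op B)) :
  [/\ L2_operator pi (metropolis_op rho B),
      L2_self_adjoint pi (metropolis_op rho B) &
      L2_positive pi (metropolis_op rho B)].

Proof.
(* This identifies the volume of [K] in [U0E] with the total mass of the trace measure. *)
have valT : trace_val @` [set: trace_type (nonempty_interior iK)] = K.
  apply/seteqP; split => [_ [x _ <-]|x Kx]; first exact: set_mem (valP x).
  by exists (SigSub (mem_set Kx) : trace_type (nonempty_interior iK)).
have [|c c0 piE'] := normalized_density rho_ge0 rho_int rho_gt0 _ piE (U := U0).
  move=> A mA; rewrite U0E//; congr (_ / _)%E.
  exact: (congr1 (lebesgue_rV R d) (esym valT)).
have r0 x : 0 <= c * rho x by rewrite mulr_ge0 ?(ltW c0).
have mr : measurable_fun setT (fun x => c * rho x).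
  apply: measurable_funM => //.
  by apply/measurable_EFinP; exact: measurable_int rho_int.
(* Only ratios of [rho] enter the acceptance probability, so [rho] may be replaced by the density
   [c * rho] of [pi] with respect to [U0]. *)
rewrite -(metropolis_op_scale B rho (lt0r_neq0 c0)); split.
- exact: metropolis_op_operator mr r0 piE' B_rev.
- exact: metropolis_op_self_adjoint mr r0 piE' B_rev.
- exact: (metropolis_op_positive B_rev B_pos mr r0 piE').
Qed.
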